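(* For $\Delta>0$, let $\mathrm{CM}^{\mathrm{LB}}_{|D|\le\Delta}$ denote the set of CM points of discriminant $D$ with $|D|\le\Delta$ lying on the left boundary $\{-\frac12+iy : y\ge \frac{\sqrt3}{2}\}$ of $\mathcal F$, and let $\mathrm{CM}^{\mathrm{LA}}_{|D|\le\Delta}$ denote the set of CM points of discriminant $D$ with $|D|\le\Delta$ lying on the lower arc $\{e^{i\theta} : \frac{\pi}{2}\le\theta\le\frac{2\pi}{3}\}$ of $\mathcal F$. Then as $\Delta\to\infty$: (1) For every fixed real $K>\frac{\sqrt3}{2}$, the set $\{\operatorname{Im}\tau : \tau\in \mathrm{CM}^{\mathrm{LB}}_{|D|\le\Delta}\}$ is equidistributed over $[\frac{\sqrt3}{2},K]$ via the metric $d\mu=\frac1y\,dy$; that is, for every fixed interval $[X,Y]\subseteq[\frac{\sqrt3}{2},K]$, $$\frac{\#\{\tau\in \mathrm{CM}^{\mathrm{LB}}_{|D|\le\Delta} : X\le\operatorname{Im}\tau\le Y\}}{\#\{\tau\in \mathrm{CM}^{\mathrm{LB}}_{|D|\le\Delta} : \frac{\sqrt3}{2}\le\operatorname{Im}\tau\le K\}}\longrightarrow\frac{\int_X^Y \frac{dy}{y}}{\int_{\sqrt3/2}^{K}\frac{dy}{y}}\qquad(\Delta\to\infty).$$ (2) The set $\{\arg\tau : \tau\in \mathrm{CM}^{\mathrm{LA}}_{|D|\le\Delta}\}$ is equidistributed over $[\frac{\pi}{2},\frac{2\pi}{3}]$ via the metric $d\nu=\frac{1}{\sin\theta}\,d\theta$;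 that is, for every fixed interval $[\alpha,\beta]\subseteq[\frac{\pi}{2},\frac{2\pi}{3}]$, $$\frac{\#\{\tau\in \mathrm{CM}^{\mathrm{LA}}_{|D|\le\Delta} : \alpha\le\arg\tau\le\beta\}}{\#\,\mathrm{CM}^{\mathrm{LA}}_{|D|\le\Delta}}\longrightarrow\frac{\int_\alpha^\beta \frac{d\theta}{\sin\theta}}{\int_{\pi/2}^{2\pi/3}\frac{d\theta}{\sin\theta}}\qquad(\Delta\to\infty).$$
   Context: Let $\mathcal H=\{z\in\mathbb C:\operatorname{Im}z>0\}$ and let $\mathcal F=\{z=x+iy\in\mathcal H : |z|\ge1,\ -\frac12\le x\le0\}\cup\{z=x+iy\in\mathcal H : |z|>1,\ 0<x<\frac12\}$ be the standard fundamental domain for $\mathrm{SL}_2(\mathbb Z)$ acting on $\mathcal H$. A CM point is a $\tau\in\mathcal H$ satisfying $a\tau^2+b\tau+c=0$ for integers $a,b,c$ with $a\ge1$ and $\gcd(a,b,c)=1$; the triple $[a,b,c]$ is uniquely determined by $\tau$, and the discriminant of $\tau$ is $D=b^2-4ac<0$. All negative discriminants (not only fundamental ones) are considered. *)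

(* Defs.v *)
From mathcomp Require Import all_boot all_order all_algebra.
From mathcomp Require Import finmap.
From mathcomp Require Import all_classical all_reals all_analysis.
From mathcomp Require Import complex.

Set Implicit Arguments.
Unset Strict Implicit.
Unset Printing Implicit Defensive.

Import Order.TTheory GRing.Theory Num.Theory.
Import numFieldNormedType.Exports.

Local Open Scope classical_set_scope.
Local Open Scope complex_scope.
Local Open Scope ring_scope.

Definition upper_half_plane (R : realType) : set R[i] :=
  [set tau | 0 < complex.Im tau].

Definition cm_form (R : realType) (tau : R[i]) (a b c : int) : Prop :=
  [/\ 1 <= a, gcdz (gcdz a b) c = 1
    & a%:~R * tau ^+ 2 + b%:~R * tau + c%:~R = 0].

(* The triple (a, b, c), hence D, is uniquely determined by tau; D < 0 follows
   from tau not being real. *)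
Definition cm_point_of_disc (R : realType) (D : int) : set R[i] :=
  [set tau | upper_half_plane tau /\
     exists a b c : int, cm_form tau a b c /\ D = b ^+ 2 - 4 * a * c].

Definition cm_points (R : realType) (Delta : R) : set R[i] :=
  [set tau | exists D : int, `|D|%:~R <= Delta /\ cm_point_of_disc D tau].

Definition expi (R : realType) (theta : R) : R[i] := cos theta +i* sin theta.

(* The principal argument, with values in ]-pi, pi], for z != 0; at z = 0 it is
   an arbitrary angle in that interval. *)
Definition arg (R : realType) (z : R[i]) : R :=
  xget 0 [set theta | - pi < theta <= pi /\ z = `|z| * expi theta].

Definition left_boundary (R : realType) : set R[i] :=
  [set tau | exists y : R, Num.sqrt 3 / 2 <= y /\ tau = (- (1 / 2)) +i* y].

Definition lower_arc (R : realType) : set R[i] :=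
  [set tau | exists theta : R, pi / 2 <= theta <= 2 * pi / 3 /\
                               tau = expi theta].

Definition cm_left_boundary (R : realType) (Delta : R) : set R[i] :=
  cm_points Delta `&` @left_boundary R.

Definition cm_lower_arc (R : realType) (Delta : R) : set R[i] :=
  cm_points Delta `&` @lower_arc R.

(* [fset_set] sends infinite sets to the empty set.  cm_left_boundary Delta and
   cm_lower_arc Delta are finite, since on them 3 * a ^ 2 <= |D| and
   4 * a * c = b ^ 2 + |D| with |b| <= a. *)
Definition ncard (R : realType) (A : set R[i]) : R := #|` fset_set A|%:R.

(* Main.v *)
(* On the left boundary a CM point is a root of [a, a, c] and is determined by
   the slope r = c / a = y ^ 2 + 1 / 4, with |D| = a ^ 2 * (4 * r - 1).  On the
   lower arc it is a root of [a, b, a], determined by r = b / a = - 2 cos theta,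
   with |D| = a ^ 2 * (4 - r ^ 2).  Both counts are thus numbers N(x) of coprime
   pairs (a, b) with slope r = b / a in [p, q] and a ^ 2 * g(r) <= x, and the
   number T(x) of all such pairs is asymptotic to x times the area, which is the
   integral of 1 / (2 * g) over [p, q].  Sorting the pairs by gcd gives
   T(x) = \sum_d N(x / d ^ 2), and N(x) / x -> area / \sum_d d ^ -2 because the
   terms d >= 2 are a contraction: \sum_(d >= 2) d ^ -2 <= 3 / 4.  In ratios of
   counts the constant cancels, and in terms of y and theta the area is 1 / 4 of
   the integral of dy / y and of d theta / sin theta. *)

Require Import Defs.
From mathcomp Require Import all_boot all_order all_algebra.
From mathcomp Require Import finmap.
From mathcomp Require Import all_classical all_reals all_analysis.
From mathcomp Require Import complex.
From mathcomp Require Import ring lra.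

Set Implicit Arguments.
Unset Strict Implicit.
Unset Printing Implicit Defensive.

Import Order.TTheory GRing.Theory Num.Theory.
Import numFieldNormedType.Exports.

Local Open Scope classical_set_scope.
Local Open Scope complex_scope.
Local Open Scope ring_scope.

(** * Lattice points in a wedge *)

(** Since [fset_set] sends an infinite set to the empty one, this is a true cardinality only on
    finite sets; finiteness facts therefore accompany the counts below. *)
Definition setcard (T : choiceType) (A : set T) : nat := #|` fset_set A|.

Lemma setcard_set0 (T : choiceType) : setcard (@set0 T) = 0%N.
Proof. by rewrite /setcard fset_set0 cardfs0. Qed.

Lemma setcard_image (T U : choiceType) (f : T -> U) (A : set T) :
  finite_set A -> {in A &, injective f} -> setcard (f @` A) = setcard A.
Proof.
move=> finA injf; rewrite /setcard fset_set_image// card_in_imfset//=.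
by move=> x y; rewrite !in_fset_set// => xA yA; exact: injf.
Qed.

Lemma setcard_le (T : choiceType) (A B : set T) :
  finite_set B -> A `<=` B -> (setcard A <= setcard B)%N.
Proof.
move=> finB AB; apply: fsubset_leq_card; rewrite -fset_set_sub//.
exact: sub_finite_set AB finB.
Qed.

Lemma setcard_setU (T : choiceType) (A B : set T) :
  finite_set A -> finite_set B -> (forall x, A x -> ~ B x) ->
  setcard (A `|` B) = (setcard A + setcard B)%N.
Proof.
move=> finA finB AB; rewrite /setcard fset_setU// cardfsU -fset_setI//.
have -> : A `&` B = set0 by rewrite -subset0 => x [/AB].
by rewrite fset_set0 cardfs0 subn0.
Qed.

Lemma setcard_II n : setcard `I_n = n.
Proof. exact/card_fset_set/card_eqxx. Qed.

Definition slope (R : realType) (ab : nat * nat) : R := ab.2%:R / ab.1%:R.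

(** The weight [a ^ 2 * g (b / a)] is homogeneous of degree 2: multiplying [(a, b)] by [d] keeps the
    slope and multiplies the weight by [d ^ 2]. For [g = 1] the region is a triangle with apex at
    the origin. *)
Definition region (R : realType) (g : R -> R) (I : interval R) (x : R) :
    set (nat * nat) :=
  [set ab | [/\ (0 < ab.1)%N, slope R ab \in I &
                ab.1%:R ^+ 2 * g (slope R ab) <= x]].

Lemma ltr_natrS (R : realType) (x : R) : exists n : nat, x < n%:R.
Proof. by exists (Num.truncn x).+1; exact: truncnS_gt. Qed.

Lemma finite_natX (R : realType) (A : set (nat * nat)) (u v : R) :
  (forall ab, A ab -> ab.1%:R <= u /\ ab.2%:R <= v) -> finite_set A.
Proof.
move=> Auv; have [n un] := ltr_natrS u; have [m vm] := ltr_natrS v.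
apply: (@sub_finite_set _ _ (`I_n `*` `I_m)); last first.
  by apply: finite_setX; exact: finite_II.
move=> ab /Auv[au bv]; split => /=.
- by rewrite -(ltr_nat R); exact: le_lt_trans un.
- by rewrite -(ltr_nat R); exact: le_lt_trans vm.
Qed.

Lemma ler_natr_sqr (R : realType) (n : nat) : n%:R <= n%:R ^+ 2 :> R.
Proof. by rewrite -natrX ler_nat; case: n => // n; rewrite leq_pmulr. Qed.

(** The weight is at least [m * a ^ 2 >= m * a], which bounds [a] by [x / m]; the bound [q] on
    slopes then bounds [b]. *)
Lemma finite_region (R : realType) (g : R -> R) (I : interval R) (q m x : R) :
  0 < m -> (forall r, r \in I -> r <= q /\ m <= g r) ->
  finite_set (region g I x).
Proof.
move=> m0 Ig.
have ax ab : region g I x ab -> ab.1%:R <= x / m.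
  case=> a0 /Ig[_ mg] agx; apply: le_trans (ler_natr_sqr _ _) _.
  rewrite ler_pdivlMr//; apply: le_trans agx.
  by rewrite ler_wpM2l// exprn_ge0.
apply: (@finite_natX _ _ (x / m) (`|q| * (x / m))) => ab abI.
split; first exact: ax.
have [a0 /Ig[rq _] _] := abI; have {}a0 : 0 < ab.1%:R :> R by rewrite ltr0n.
have : ab.2%:R <= q * ab.1%:R by rewrite -ler_pdivrMr.
move=> /le_trans; apply; apply: (@le_trans _ _ (`|q| * ab.1%:R)).
  by rewrite ler_wpM2r ?ler_norm// ltW.
by rewrite ler_wpM2l// ax.
Qed.

(** Whichever inequality [c] selects, the set contains the first [truncn v] naturals and is
    contained in the first [truncn v + 1]. *)
Lemma setcard_nat_below (R : realType) (c : bool) (v : R) : 0 <= v ->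
  finite_set [set b : nat | b%:R < v ?<= if c] /\
  v - 1 <= (setcard [set b : nat | b%:R < v ?<= if c])%:R <= v + 1.
Proof.
move=> v0; set A := [set b : nat | _]; have /andP[tv vt] := truncn_itv v0.
have sub : A `<=` `I_(Num.truncn v).+1.
  move=> b /lteifW bv; rewrite /= ltnS truncn_ge_nat//.
have finA : finite_set A by apply: sub_finite_set sub (finite_II _).
split=> //; have := setcard_le (@finite_II _) sub; rewrite setcard_II => h1.
have /(setcard_le finA) : `I_(Num.truncn v) `<=` A.
  move=> b /= bv; apply: lteifS; apply: lt_le_trans tv.
  by rewrite ltr_nat.
rewrite setcard_II => h2; apply/andP; split.
- rewrite lerBlDr; apply/ltW; apply: lt_le_trans vt _.
  by rewrite -natr1 lerD2r ler_nat.
- apply: (@le_trans _ _ (Num.truncn v).+1%:R); first by rewrite ler_nat.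
  by rewrite -natr1 lerD2r.
Qed.

(** The points of row [a] are the difference of two initial segments of the naturals, each counted
    with error at most 1. The flag [l] decides whether slope [s] is included; the segment removed
    uses the opposite choice [~~ l]. *)
Lemma setcard_nat_itv (R : realType) (l : bool) (s t : R) (a : nat) :
  (0 < a)%N -> 0 <= s -> s <= t ->
  let A := [set b : nat | slope R (a, b) \in Interval (BSide l s) (BRight t)] in
  finite_set A /\ `|(setcard A)%:R - (t - s) * a%:R| <= 2.
Proof.
move=> a0 s0 st A; have aR : 0 < a%:R :> R by rewrite ltr0n.
have [finS cS] := @setcard_nat_below R (~~ l) (s * a%:R) (mulr_ge0 s0 (ltW aR)).
have [finT cT] := @setcard_nat_below R true (t * a%:R)
  (mulr_ge0 (le_trans s0 st) (ltW aR)).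
set S := [set b : nat | _] in finS cS; set T := [set b : nat | _] in finT cT.
have TE : T = S `|` A.
  apply/seteqP; split => b; rewrite /T /S /A /= /slope /= in_itv/=.
  - move=> bt; have [bs|] := boolP (b%:R < s * a%:R ?<= if ~~ l); [by left|].
    rewrite -lteifNE negbK => bs; right.
    by rewrite lteif_pdivlMr// bs/= ler_pdivrMr.
  - case=> [/lteifW bs|/andP[_]]; last by rewrite ler_pdivrMr.
    by apply: le_trans bs _; rewrite ler_wpM2r// ltW.
have finA : finite_set A.
  by apply: sub_finite_set finT; rewrite TE; exact: subsetUr.
split=> //.
have : setcard T = (setcard S + setcard A)%N.
  rewrite TE setcard_setU// => b; rewrite /S /A /= /slope/= in_itv/= => bs.
  move=> /andP[+ _]; rewrite lteif_pdivlMr//.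
  by apply/negP; rewrite -lteifNE.
move=> /(congr1 (fun n => n%:R : R)); rewrite natrD => cTE.
rewrite ler_norml; move: cS cT => /andP[? ?] /andP[? ?].
by apply/andP; split; lra.
Qed.

Lemma setcard_rows (R : realType) (l : bool) (s t : R) (n : nat) :
  0 <= s -> s <= t ->
  let A := [set ab : nat * nat | [/\ (0 < ab.1)%N, (ab.1 <= n)%N &
    slope R ab \in Interval (BSide l s) (BRight t)]] in
  finite_set A /\ `|(setcard A)%:R - (t - s) * (n%:R * (n%:R + 1) / 2)| <= 2 * n%:R.
Proof.
move=> s0 st; elim: n => [|n [finA IH]].
  move=> A; have -> : A = set0 by rewrite -subset0 => -[[|a] b] [].
  by rewrite setcard_set0 !mul0r !mulr0 subrr normr0; split.
move: finA IH; set A := [set ab | _] => finA IH.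
set B := [set ab : nat * nat | _].
have [finC cC] := @setcard_nat_itv R l s t n.+1 isT s0 st.
set C := [set b : nat | _] in finC cC.
have BE : B = A `|` pair n.+1 @` C.
  apply/seteqP; split => -[a b] /=.
  - move=> [a0 + abI]; rewrite leq_eqVlt => /predU1P[an|an]; last by left.
    by right; exists b; rewrite -?an//= /C/= -an.
  - case=> [[a0 an abI]|[b' Cb' [<- <-]]]; last by split.
    by split => //; exact: leq_trans an _.
have finC' : finite_set (pair n.+1 @` C) by exact: finite_image.
rewrite BE; split; first by rewrite finite_setU.
rewrite setcard_setU//; last first.
  by move=> [a b] [/= _ an _] [b' _ [an' _]]; rewrite -an' ltnn in an.
rewrite setcard_image//; last by move=> b b' _ _ [].
rewrite natrD -natr1; apply: le_trans (_ : 2 * n%:R + 2 <= _); last by lra.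
apply: le_trans (_ : `|((setcard A)%:R - (t - s) * (n%:R * (n%:R + 1) / 2)) +
  ((setcard C)%:R - (t - s) * n.+1%:R)| <= _); last first.
  by apply: le_trans (ler_normD _ _) _; rewrite lerD.
by rewrite -natr1 le_eqVlt; apply/orP; left; apply/eqP; congr `|_|; field.
Qed.

(** The rows are [1 <= a <= N] with [N = truncn (sqrt y)]. Summing them gives
    [(t - s) * N * (N + 1) / 2] up to [2 * N], and [N * (N + 1)] differs from [y] by at most
    [sqrt y]. *)
Lemma setcard_wedge (R : realType) (l : bool) (s t y : R) :
  0 <= s -> s <= t -> 0 <= y ->
  `|(setcard (region (fun=> 1) (Interval (BSide l s) (BRight t)) y))%:R
     - (t - s) / 2 * y| <= (2 + (t - s)) * Num.sqrt y.
Proof.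
move=> s0 st y0; set A := region _ _ _.
have z0 := sqrtr_ge0 y; have /andP[nz zn] := truncn_itv z0.
have [_] := @setcard_rows R l s t (Num.truncn (Num.sqrt y)) s0 st.
set B := [set ab | _]; have -> : A = B.
  apply/seteqP; split => -[a b]; rewrite /A /B /region /=.
  - case=> a0 abI; rewrite mulr1 => ay; split => //.
    by rewrite truncn_ge_nat// -(@ler_sqr R) ?nnegrE// sqr_sqrtr.
  - case=> a0 + abI; rewrite truncn_ge_nat// => ay; split => //.
    by rewrite mulr1 -(sqr_sqrtr y0) ler_sqr ?nnegrE.
set n := Num.truncn _ in nz zn *; move: nz zn; rewrite -natr1.
rewrite -[X in _ / 2 * X](sqr_sqrtr y0).
set z := Num.sqrt y in z0 *; set N := n%:R => nz zn; set c := (setcard B)%:R.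
have N0 : 0 <= N by rewrite ler0n.
have h1 : N * (N + 1) <= z ^+ 2 + z by nra.
have h2 : z ^+ 2 - z <= N * (N + 1) by nra.
have h3 : `|(t - s) * (N * (N + 1) / 2) - (t - s) / 2 * z ^+ 2| <= (t - s) * z.
  have -> : (t - s) * (N * (N + 1) / 2) - (t - s) / 2 * z ^+ 2 =
    (t - s) * ((N * (N + 1) - z ^+ 2) / 2) by field.
  rewrite normrM ger0_norm ?subr_ge0// ler_wpM2l ?subr_ge0//.
  by rewrite ler_norml; apply/andP; split; lra.
move: h3; rewrite !ler_norml => /andP[h3 h4] /andP[h5 h6].
by apply/andP; split; lra.
Qed.

(** * Lattice points of bounded weight *)

Lemma near_sqrt_le (R : realType) (C e : R) : 0 <= C -> 0 < e ->
  \forall x \near +oo, C * Num.sqrt x <= e * x.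
Proof.
move=> C0 e0; near=> x.
have x0 : 0 <= x by [].
have Cx : C / e <= Num.sqrt x.
  rewrite -(@ler_sqr R) ?nnegrE ?divr_ge0 ?sqrtr_ge0 ?(ltW e0)// sqr_sqrtr//.
have : C <= e * Num.sqrt x by rewrite mulrC -ler_pdivrMr.
by move=> /(ler_wpM2r (sqrtr_ge0 x)); rewrite -mulrA -expr2 sqr_sqrtr.
Unshelve. all: by end_near. Qed.

(** As [lo <= g <= hi] on the slopes concerned, the region lies between the triangles of parameters
    [x / hi] and [x / lo]. Both being at most [x], the error terms can be stated with [sqrt x]. *)
Lemma setcard_region_bounds (R : realType) (g : R -> R) (l : bool)
    (s t lo hi x : R) :
  0 <= s -> s <= t -> 1 <= lo -> lo <= hi -> 0 <= x ->
  (forall r, s <= r <= t -> lo <= g r <= hi) ->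
  (t - s) / 2 * (x / hi) - (2 + (t - s)) * Num.sqrt x <=
    (setcard (region g (Interval (BSide l s) (BRight t)) x))%:R <=
  (t - s) / 2 * (x / lo) + (2 + (t - s)) * Num.sqrt x.
Proof.
move=> s0 st lo1 lohi x0 gI; set I := Interval _ _.
have lo0 : 0 < lo by exact: lt_le_trans lo1.
have hi0 : 0 < hi by exact: lt_le_trans lohi.
have IE r : r \in I -> s <= r <= t.
  by rewrite /I in_itv/= => /andP[/lteifW-> ->].
have fing (h : R -> R) (m y : R) : 0 < m ->
    (forall r, s <= r <= t -> m <= h r) -> finite_set (region h I y).
  move=> m0 hI; apply: (@finite_region _ _ _ t m) => // r /IE rst.
  by split; [case/andP: rst|exact: hI].
have sub1 : region (fun=> 1) I (x / hi) `<=` region g I x.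
  move=> -[a b] [/= a0 abI]; rewrite mulr1 ler_pdivlMr// => ax; split => //=.
  apply: le_trans ax; rewrite ler_wpM2l ?exprn_ge0//.
  by case/andP: (gI _ (IE _ abI)).
have sub2 : region g I x `<=` region (fun=> 1) I (x / lo).
  move=> -[a b] [/= a0 abI] ax; split => //=.
  rewrite mulr1 ler_pdivlMr//; apply: le_trans ax.
  rewrite ler_wpM2l ?exprn_ge0//.
  by case/andP: (gI _ (IE _ abI)).
have c1 := setcard_le (fing g lo x lo0 (fun r h => proj1 (andP (gI r h)))) sub1.
have c2 := setcard_le (fing (fun=> 1) 1 (x / lo) ltr01 (fun r h => lexx _)) sub2.
have sq k : 1 <= k -> (2 + (t - s)) * Num.sqrt (x / k) <= (2 + (t - s)) * Num.sqrt x.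
  move=> k1; apply: ler_wpM2l; first by rewrite addr_ge0// subr_ge0.
  by apply: ler_wsqrtr; rewrite ler_pdivrMr ?(lt_le_trans _ k1)// ler_peMr.
have /ler_normlP[w1 w2] := setcard_wedge l s0 st (divr_ge0 x0 (ltW hi0)).
have /ler_normlP[w3 w4] := setcard_wedge l s0 st (divr_ge0 x0 (ltW lo0)).
have sq1 := sq _ lo1; have sq2 := sq _ (le_trans lo1 lohi).
rewrite -/I in w1 w2 w3 w4.
move: c1 c2; rewrite -!(ler_nat R) => c1 c2.
by apply/andP; split; lra.
Qed.

(* [F] is a primitive of the area density [1 / (2 * g)] of the region
   [a ^ 2 * g (b / a) <= 1] with respect to the slope [b / a]. *)
Record slope_density (R : realType) (g F : R -> R) (p q : R) : Prop :=
  SlopeDensity {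
  slope_ge0 : 0 <= p;
  slope_le : p <= q;
  density_ge1 : forall r, p <= r <= q -> 1 <= g r;
  density_monotone : forall s r t, p <= s -> s <= r -> r <= t -> t <= q ->
    Num.min (g s) (g t) <= g r <= Num.max (g s) (g t);
  density_lipschitz : exists2 L, 0 <= L &
    forall s t, p <= s -> s <= t -> t <= q -> `|g t - g s| <= L * (t - s);
  density_primitive : forall r, p <= r <= q -> is_derive r 1 F (2 * g r)^-1 }.

(** By the mean value theorem [F t - F s = (t - s) / (2 * g r)] for some [r] in [[s, t]], so the
    expected count lies between the main terms of the two bounding triangles. Their gap is
    [(t - s) / 2 * (1 / lo - 1 / hi) * x]. Since [lo] and [hi] are at least 1, [1 / lo - 1 / hi <=
    hi - lo <= L * (t - s)], whence an error quadratic in the width. *)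
Lemma setcard_region_piece (R : realType) (g F : R -> R) (p q L s t x : R)
    (l : bool) :
  slope_density g F p q ->
  (forall s t, p <= s -> s <= t -> t <= q -> `|g t - g s| <= L * (t - s)) ->
  p <= s -> s <= t -> t <= q -> 0 <= x ->
  `|(setcard (region g (Interval (BSide l s) (BRight t)) x))%:R - (F t - F s) * x|
  <= L / 2 * (t - s) ^+ 2 * x + (2 + (t - s)) * Num.sqrt x.
Proof.
move=> [p0 pq g1 gmono _ dF] gL ps st tq x0.
set lo := Num.min (g s) (g t); set hi := Num.max (g s) (g t).
have gst r : s <= r <= t -> lo <= g r <= hi.
  by move=> /andP[sr rt]; exact: gmono.
have g1' r : s <= r <= t -> 1 <= g r.
  by move=> /andP[? ?]; apply: g1; apply/andP; split; lra.
have lo1 : 1 <= lo by rewrite le_min !g1' ?lexx ?st.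
have /andP[slo shi] : lo <= g s <= hi by apply: gst; rewrite lexx.
have lohi := le_trans slo shi.
have hilo : hi - lo <= L * (t - s).
  apply: le_trans (gL s t ps st tq); rewrite /hi /lo.
  rewrite /Num.min /Num.max; case: ltP => _; first exact: ler_norm.
  by rewrite distrC ler_norm.
have := setcard_region_bounds l (le_trans p0 ps) st lo1 lohi x0 gst.
set c := (setcard _)%:R => /andP[c1 c2].
have [r rst FE] : exists2 r, r \in `[s, t] & F t - F s = (2 * g r)^-1 * (t - s).
  have dF' r : s <= r <= t -> is_derive r 1 F (2 * g r)^-1.
    by move=> /andP[? ?]; apply: dF; apply/andP; split; lra.
  apply: (@MVT_segment _ F (fun r => (2 * g r)^-1)) => // [r|].
    by rewrite in_itv/= => /andP[/ltW ? /ltW ?]; apply: dF'; apply/andP.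
  apply: derivable_within_continuous => r; rewrite in_itv/= => rst.
  by have [] := dF' r rst.
move: rst; rewrite in_itv/= => /gst/andP[lor rhi].
have lo0 : 0 < lo by apply: lt_le_trans lo1.
have gr0 : 0 < g r by apply: lt_le_trans lor.
have hi0 : 0 < hi by apply: lt_le_trans lohi.
have st0 : 0 <= t - s by rewrite subr_ge0.
have FE' : (F t - F s) * x = (t - s) / 2 * (x * (g r)^-1).
  by rewrite FE; field; rewrite gt_eqF.
have i1 : hi^-1 <= (g r)^-1 by rewrite lef_pV2.
have i2 : (g r)^-1 <= lo^-1 by rewrite lef_pV2.
have i3 : lo^-1 - hi^-1 <= L * (t - s).
  apply: le_trans hilo.
  have -> : lo^-1 - hi^-1 = (hi - lo) * (lo^-1 * hi^-1).
    by field; rewrite !gt_eqF.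
  rewrite -[leRHS]mulr1 ler_wpM2l ?subr_ge0//.
  apply: mulr_ile1; rewrite ?invr_ge0 ?(ltW lo0) ?(ltW hi0)//.
    by rewrite invf_le1.
  by rewrite invf_le1// (le_trans lo1).
have tx0 : 0 <= (t - s) / 2 * x by rewrite mulr_ge0// divr_ge0.
have j1 := ler_wpM2l tx0 i1; have j2 := ler_wpM2l tx0 i2.
have j3 := ler_wpM2l tx0 i3.
rewrite FE' ler_norml; apply/andP; split; lra.
Qed.

Lemma finite_slope_region (R : realType) (g F : R -> R) (p q s t x : R) (l : bool) :
  slope_density g F p q -> p <= s -> t <= q ->
  finite_set (region g (Interval (BSide l s) (BRight t)) x).
Proof.
move=> [p0 pq g1 _ _ _] ps tq; apply: (@finite_region _ _ _ q 1) => // r.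
rewrite in_itv/= => /andP[/lteifW sr rt]; split; first exact: le_trans tq.
by apply: g1; rewrite (le_trans ps sr) (le_trans rt tq).
Qed.

(** Adjacent pieces are made disjoint by taking them half-open, []s, t]]. The quadratic errors add
    up to order [k * h ^ 2], which is small for a fine partition. *)
Lemma setcard_region_partition (R : realType) (g F : R -> R) (p q L h x : R)
    (k : nat) :
  slope_density g F p q ->
  (forall s t, p <= s -> s <= t -> t <= q -> `|g t - g s| <= L * (t - s)) ->
  0 <= h -> p + k%:R * h <= q -> 0 <= x ->
  `|(setcard (region g `[p, p + k%:R * h] x))%:R - (F (p + k%:R * h) - F p) * x|
  <= k%:R * (L / 2 * h ^+ 2 * x) + (k.+1)%:R * ((2 + (q - p)) * Num.sqrt x).
Proof.
move=> gF gL h0 + x0; have sx := sqrtr_ge0 x; have pq := slope_le gF.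
elim: k => [_|k IH].
  (* The induction starts from the single slope [p], whose region may contain points and costs one
     square-root error; hence the factor [k.+1] instead of [k]. *)
  rewrite mul0r addr0 mul0r add0r mul1r.
  have := setcard_region_piece true gF gL (lexx p) (lexx p) pq x0.
  rewrite (subrr p) expr0n/= mulr0 mul0r add0r addr0 => /le_trans; apply.
  by rewrite ler_wpM2r// lerDl subr_ge0.
set s := p + k%:R * h; have tE : p + k.+1%:R * h = s + h.
  by rewrite /s -natr1; lra.
rewrite tE; set t := s + h => tq.
have st : s <= t by rewrite lerDl.
have sq := le_trans st tq; have {IH} := IH sq; rewrite -/s => IH.
have ps : p <= s by rewrite lerDl mulr_ge0.
have := setcard_region_piece false gF gL ps st tq x0.
have -> : t - s = h by rewrite /t; lra.
move=> piece.
have fin1 := finite_slope_region x true gF (lexx p) sq.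
have fin2 := finite_slope_region x false gF ps tq.
have -> : region g `[p, t] x = region g `[p, s] x `|` region g `]s, t] x.
  apply/seteqP; split => ab.
  - case=> a0; rewrite in_itv/= => /andP[pr rt] abx.
    have [rs|sr] := lerP (slope R ab) s.
      by left; split => //; rewrite in_itv/= pr.
    by right; split => //; rewrite in_itv/= sr.
  - case=> -[a0]; rewrite in_itv/= => /andP[pr rt] abx.
      by split => //; rewrite in_itv/= pr (le_trans rt).
    by split => //; rewrite in_itv/= (le_trans ps (ltW pr)).
rewrite setcard_setU//; last first.
  move=> ab [_ + _] [_ + _]; rewrite !in_itv/= => /andP[_ rs] /andP[sr _].
  by rewrite ltNge rs in sr.
have hq : (2 + h) * Num.sqrt x <= (2 + (q - p)) * Num.sqrt x.
  by rewrite ler_wpM2r//; move: tq; rewrite /t; lra.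
rewrite natrD.
set c1 := (setcard _)%:R in IH *; set c2 := (setcard _)%:R in piece *.
have -> : c1 + c2 - (F t - F p) * x =
  (c1 - (F s - F p) * x) + (c2 - (F t - F s) * x) by lra.
apply: le_trans (ler_normD _ _) _.
apply: le_trans (lerD IH piece) _; rewrite -!natr1; lra.
Qed.

Lemma setcard_region_cvg (R : realType) (g F : R -> R) (p q : R) :
  slope_density g F p q ->
  (setcard (region g `[p, q] x))%:R / x @[x --> +oo] --> F q - F p.
Proof.
move=> gF; have [L L0 gL] := density_lipschitz gF; have pq := slope_le gF.
apply/cvgrPdist_le => e e0.
(* With [n] pieces of width [(q - p) / n] the quadratic errors total
   [L * (q - p) ^ 2 / (2 * n) * x], which this [n] keeps below [e / 2 * x]. Only then is [x] taken
   large, so that the square-root errors fit in the other half. *)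
have [n hn] := ltr_natrS (L / e * (q - p) ^+ 2).
have n0 : 0 < n%:R :> R.
  by apply: le_lt_trans hn; rewrite mulr_ge0 ?sqr_ge0// divr_ge0// ltW.
have C0 : 0 <= n.+1%:R * (2 + (q - p)).
  by rewrite mulr_ge0// addr_ge0// subr_ge0.
have := near_sqrt_le C0 (divr_gt0 e0 (ltr0n _ 2)) => sqx.
near=> x.
have x0 : 0 < x by [].
have sx : n.+1%:R * (2 + (q - p)) * Num.sqrt x <= e / 2 * x by near: x.
have pnq : p + n%:R * ((q - p) / n%:R) = q by field; rewrite gt_eqF.
have h0 : 0 <= (q - p) / n%:R by rewrite divr_ge0// subr_ge0.
have := @setcard_region_partition _ _ _ _ _ L _ x n gF gL h0.
rewrite pnq => /(_ (lexx q) (ltW x0)); set c := (setcard _)%:R => H.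
have -> : F q - F p - c / x = - ((c - (F q - F p) * x) / x).
  by field; rewrite gt_eqF.
rewrite normrN normrM normfV (gtr0_norm x0) ler_pdivrMr//.
apply: le_trans H _.
suff : n%:R * (L / 2 * ((q - p) / n%:R) ^+ 2 * x) <= e / 2 * x by lra.
have -> : n%:R * (L / 2 * ((q - p) / n%:R) ^+ 2 * x) =
  (L / e * (q - p) ^+ 2) / n%:R * (e / 2 * x).
  by field; rewrite !gt_eqF.
rewrite -[leRHS]mul1r ler_wpM2r ?mulr_ge0 ?divr_ge0 ?(ltW e0) ?(ltW x0)//.
by rewrite ler_pdivrMr// mul1r ltW.
Unshelve. all: by end_near. Qed.

(** A linear bound valid down to [x = 0], since the inversion below evaluates counts at the possibly
    tiny [x / d ^ 2]. For [x < 1] the region is empty because weights are at least 1; for [x >= 1]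
    the triangle bound applies with [sqrt x <= x]. *)
Lemma setcard_region_le (R : realType) (g F : R -> R) (p q x : R) :
  slope_density g F p q -> 0 < x ->
  (setcard (region g `[p, q] x))%:R <= (3 * (1 + (q - p))) * x.
Proof.
move=> gF x0; have [p0 pq g1 _ _ _] := gF.
have qp0 : 0 <= q - p by rewrite subr_ge0.
have [x1|x1] := ltP x 1.
  have -> : region g `[p, q] x = set0.
    rewrite -subset0 => -[a b] [/= a0 abI]; apply/negP; rewrite -ltNge.
    apply: lt_le_trans x1 _; rewrite mulr_ege1//.
      by rewrite exprn_ege1// ler1n.
    by apply: g1; move: abI; rewrite in_itv.
  by rewrite setcard_set0 mulr_ge0 ?(ltW x0)//; lra.
have sub : region g `[p, q] x `<=` region (fun=> 1) `[p, q] x.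
  move=> ab [a0 abI abx]; split => //; apply: le_trans abx.
  by rewrite ler_wpM2l ?exprn_ge0//; apply: g1; move: abI; rewrite in_itv.
have fin : finite_set (region (fun=> 1) `[p, q] x).
  apply: (@finite_region _ _ _ q 1) => // r.
  by rewrite in_itv/= => /andP[_ ->].
have /ler_normlP[_ w] := setcard_wedge true p0 pq (ltW x0).
have := setcard_le fin sub; rewrite -(ler_nat R) => cle.
have sx : Num.sqrt x <= x.
  rewrite -(@ler_sqr R) ?nnegrE ?sqrtr_ge0 ?(ltW x0)// sqr_sqrtr ?(ltW x0)//.
  by rewrite expr2 ler_peMr// ltW.
have sq : (2 + (q - p)) * Num.sqrt x <= (2 + (q - p)) * x.
  by rewrite ler_wpM2l// addr_ge0.
have : 0 <= (q - p) * x by rewrite mulr_ge0// ltW.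
by lra.
Qed.

(** * Primitive lattice points *)

Definition primitive_region (R : realType) (g : R -> R) (I : interval R)
    (x : R) : set (nat * nat) :=
  region g I x `&` [set ab | coprime ab.1 ab.2].

(** Dividing a point of gcd [d] by [d] gives a primitive point of the same slope and of weight
    smaller by [d ^ 2]. The sum stops at [truncn x] because the gcd is at most [a <= a ^ 2], hence
    at most the weight. *)
Lemma setcard_region_sum (R : realType) (g F : R -> R) (p q x : R) :
  slope_density g F p q -> 0 <= x ->
  setcard (region g `[p, q] x) =
  (\sum_(1 <= d < (Num.truncn x).+1)
     setcard (primitive_region g `[p, q] (x / d%:R ^+ 2)))%N.
Proof.
move=> gF x0; have [p0 pq g1 _ _ _] := gF; set I := `[p, q].
have fin y : finite_set (region g I y).
  exact: finite_slope_region gF (lexx p) (lexx q).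
(* The induction runs on a bound [m] for the gcd: passing from [m] to [m.+1] adds exactly the
   multiples by [m.+1] of primitive points. [G 0] is empty because [a > 0]. *)
pose G m := region g I x `&` [set ab | gcdn ab.1 ab.2 <= m]%N.
have -> : region g I x = G (Num.truncn x).
  apply/seteqP; split => [ab|ab []//]; move=> abI; split => //.
  have [a0 abr abx] := abI; rewrite /= truncn_ge_nat//.
  apply: le_trans abx; apply: (@le_trans _ _ (ab.1%:R ^+ 2)).
    apply: (@le_trans _ _ ab.1%:R); last exact: ler_natr_sqr.
    by rewrite ler_nat dvdn_leq// dvdn_gcdl.
  by rewrite ler_peMr ?exprn_ge0// g1//; move: abr; rewrite in_itv.
elim: (Num.truncn x) => [|m IH].
  rewrite big_geq//; have -> : G 0%N = set0; last exact: setcard_set0.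
  rewrite -subset0 => ab [[a0 _ _]] /=; rewrite leqn0 => /eqP ab0.
  by have := gcdn_gt0 ab.1 ab.2; rewrite ab0 a0.
rewrite big_nat_recr//= -IH; set d := m.+1.
have d0 : 0 < d%:R :> R by rewrite ltr0n.
pose f (ab : nat * nat) := (d * ab.1, d * ab.2)%N.
have rf ab : slope R (f ab) = slope R ab.
  rewrite /slope /f/= !natrM.
  case: ab => -[|a] b /=; first by rewrite mulr0 invr0 !mulr0.
  by field; rewrite gt_eqF//= pnatr_eq0.
set P := primitive_region g I (x / d%:R ^+ 2).
have finP : finite_set P by apply: sub_finite_set (fin _); exact: subIsetl.
have -> : G d = G m `|` f @` P.
  apply/seteqP; split => ab.
  - move=> [abI]; rewrite /= leq_eqVlt => /predU1P[gd|]; last by left.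
    right; have [a0 abr abx] := abI.
    have da : (d %| ab.1)%N by rewrite -gd dvdn_gcdl.
    have db : (d %| ab.2)%N by rewrite -gd dvdn_gcdr.
    pose ab' := (ab.1 %/ d, ab.2 %/ d)%N.
    have fE : f ab' = ab.
      by rewrite /f/= mulnC divnK// mulnC divnK//; case: (ab).
    exists ab' => //; split; last first.
      rewrite /= /coprime -(eqn_pmul2l (ltn0Sn m)) muln_gcdr.
      by rewrite mulnC divnK// mulnC divnK// gd muln1.
    split; first by rewrite /= divn_gt0// dvdn_leq.
      by rewrite -rf fE.
    rewrite ler_pdivlMr ?exprn_gt0// -rf fE mulrAC -exprMn -natrM.
    by rewrite /= divnK.
  - case=> [[abI /= gm]|[[a b] [[/= a0 abr abx] cop] <-]].
      by split => //=; exact: leq_trans gm _.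
    split; last by rewrite /= -muln_gcdr; move: cop => /= /eqP ->; rewrite muln1.
    split; rewrite ?rf//; first by rewrite /f/= muln_gt0.
    rewrite (natrM R d a : (f (a, b)).1%:R = _) exprMn -mulrA mulrC.
    by rewrite -ler_pdivlMr// exprn_gt0.
have finG : finite_set (G m) by apply: sub_finite_set (fin x); exact: subIsetl.
have finfP : finite_set (f @` P) by exact: finite_image.
rewrite setcard_setU//; last first.
  move=> ab [_ /= gm] [[a b] [_ /= /eqP cop] abE]; move: gm.
  by rewrite -abE /f /= -muln_gcdr cop muln1 /d ltnn.
congr addn; rewrite setcard_image// => -[a b] [a' b'] _ _ [].
by move=> /eqP + /eqP; rewrite !eqn_mul2l /= => /eqP -> /eqP ->.
Qed.

(** * Inversion of sums over inverse squares *)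

Definition inv_squares (R : realType) (n : nat) : R :=
  \sum_(1 <= d < n.+1) (d%:R ^+ 2)^-1.

Lemma inv_square_le (R : realType) (n : nat) : (0 < n)%N ->
  (n.+1%:R ^+ 2)^-1 <= n%:R^-1 - n.+1%:R^-1 :> R.
Proof.
move=> n0; have n0R : 0 < n%:R :> R by rewrite ltr0n.
have n1R : 0 < n.+1%:R :> R by rewrite ltr0n.
have -> : n%:R^-1 - n.+1%:R^-1 = (n%:R * n.+1%:R)^-1 :> R.
  by rewrite -natr1; field; rewrite natr1 !gt_eqF.
rewrite lef_pV2 ?posrE ?mulr_gt0 ?exprn_gt0// expr2 ler_wpM2r ?ltW//.
by rewrite ltr_nat.
Qed.

(** Telescoping of [1 / d ^ 2 <= 1 / (d - 1) - 1 / d]. *)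
Lemma inv_squares_tail (R : realType) (n m : nat) : (0 < n)%N ->
  \sum_(n.+1 <= d < m.+1) (d%:R ^+ 2)^-1 <= n%:R^-1 :> R.
Proof.
move=> n0; have [mn|nm] := leqP m n; first by rewrite big_geq// invr_ge0.
suff : \sum_(n.+1 <= d < m.+1) (d%:R ^+ 2)^-1 <= n%:R^-1 - m%:R^-1 :> R.
  by move=> /le_trans; apply; rewrite lerBlDr lerDl invr_ge0.
elim: m nm => // m IH; rewrite ltnS leq_eqVlt => /predU1P[<-|nm].
  by rewrite big_nat1; exact: inv_square_le.
rewrite big_nat_recr/=; last exact: leqW.
apply: le_trans (lerD (IH nm) (@inv_square_le R m (ltn_trans n0 nm))) _.
by rewrite addrA subrK.
Qed.

Lemma inv_squares_lt1 (R : realType) (n : nat) :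
  \sum_(2 <= d < n.+1) (d%:R ^+ 2)^-1 <= 3 / 4 :> R.
Proof.
have [n2|n2] := ltnP n 2; first by rewrite big_geq// divr_ge0.
(* The term [d = 2] gives 1/4 and the tail beyond 2 is at most 1/2. *)
have -> : 3 / 4 = (2 ^+ 2)^-1 + 2^-1 :> R by field.
by rewrite big_ltn// lerD2l inv_squares_tail.
Qed.

Lemma inv_squares_cvg (R : realType) :
  exists2 Z : R, 0 < Z & inv_squares R n @[n --> \oo] --> Z.
Proof.
have nd : {homo inv_squares R : n m / (n <= m)%N >-> n <= m}.
  apply/nondecreasing_seqP => n; rewrite /inv_squares [leRHS]big_nat_recr//=.
  by rewrite lerDl invr_ge0 exprn_ge0.
have ub : has_ubound (range (inv_squares R)).
  exists 2 => _ [n _ <-]; rewrite /inv_squares.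
  case: n => [|n]; first by rewrite big_geq.
  by rewrite big_ltn//; have := inv_squares_lt1 R n.+1; rewrite expr1n invr1; lra.
have cv := nondecreasing_is_cvgn nd ub.
exists (limn (inv_squares R)) => //.
apply: (@lt_le_trans _ _ (inv_squares R 1)).
  by rewrite /inv_squares big_nat1 expr1n invr1.
exact: nondecreasing_cvgn_le.
Qed.

Lemma truncn_cvg (R : realType) : Num.truncn x @[x --> (+oo : set_system R)] --> \oo.
Proof.
move=> A [n _ nA]; suff : \forall x \near +oo%R, A (Num.truncn (x : R)) by [].
near=> x; apply: nA => /=.
have x0 : 0 <= x by [].
by rewrite truncn_ge_nat.
Unshelve. all: by end_near. Qed.

(** The shape of the gcd decomposition in [setcard_region_sum], for an arbitrary function [N] in
    place of the primitive count. *)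
Definition inv_square_transform (R : realType) (N : R -> R) (x : R) : R :=
  \sum_(1 <= d < (Num.truncn x).+1) N (x / d%:R ^+ 2).

(* The term [d = 1] dominates since the others have total weight
   [\sum_(d >= 2) d ^- 2 <= 3 / 4 < 1]. *)
Lemma inv_square_transform_contraction (R : realType) (N : R -> R) (B b : R) :
  (forall y, 0 < y -> `|N y| <= B * y) ->
  inv_square_transform N x / x @[x --> +oo] --> 0 ->
  0 < b -> (\forall x \near +oo, `|N x| <= b * x) ->
  \forall x \near +oo, `|N x| <= 7 / 8 * b * x.
Proof.
move=> NB /cvgr0Pnorm_le cvT b0 [x0 [_ bN]].
have B0 : 0 <= B by have := NB 1 ltr01; rewrite mulr1; exact: le_trans.
(* The factor splits as 7/8 = 1/16 + 3/4 + 1/16, for the transform, the terms [2 <= d <= n] and the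
   terms [d > n]. The last are bounded through [B] by [B * x / n], which this [n] makes at most
   [b / 16 * x]. *)
have [n nB] := ltr_natrS (16 * B / b).
have n0 : 0 < n%:R :> R.
  by apply: le_lt_trans nB; rewrite divr_ge0 ?mulr_ge0// ltW.
have n1 : (0 < n)%N by rewrite -(ltr0n R).
have {}cvT := cvT _ (divr_gt0 b0 (ltr0n _ 16)).
near=> x.
have xpos : 0 < x by [].
have xn : n%:R <= x by [].
(* This keeps [x / d ^ 2] above [x0] for every [d <= n], where the asymptotic bound by [b] is
   available. *)
have xx0 : x0 * n%:R ^+ 2 < x by near: x; apply: nbhs_pinfty_gt; exact: num_real.
have : `|inv_square_transform N x / x| <= b / 16 by near: x.
rewrite normrM normfV (gtr0_norm xpos) ler_pdivrMr// => Tx.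
have nt : (n <= Num.truncn x)%N by rewrite truncn_ge_nat// ltW.
have t0 : (0 < Num.truncn x)%N by exact: leq_trans nt.
pose S u v := \sum_(u <= d < v) N (x / d%:R ^+ 2).
have split : inv_square_transform N x = N x + S 2%N n.+1 + S n.+1 (Num.truncn x).+1.
  rewrite /inv_square_transform big_ltn ?ltnS// expr1n divr1 -addrA; congr +%R.
  by rewrite /S -big_cat_nat.
have S1 : `|S 2%N n.+1| <= b * x * (3 / 4).
  apply: le_trans (ler_norm_sum _ _ _) _.
  apply: (@le_trans _ _ (\sum_(2 <= d < n.+1) b * x * (d%:R ^+ 2)^-1)).
    apply: ler_sum_nat => d /andP[d2 dn]; rewrite -mulrA; apply: bN.
    have dpos : 0 < d%:R :> R by rewrite ltr0n (leq_trans _ d2).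
    rewrite ltr_pdivlMr ?exprn_gt0//.
    have [x00|x00] := lerP x0 0.
      by apply: le_lt_trans xpos; rewrite mulr_le0_ge0// exprn_ge0// ltW.
    apply: le_lt_trans xx0; rewrite ler_wpM2l ?(ltW x00)//.
    by rewrite ler_sqr ?nnegrE// ?ler_nat.
  by rewrite -mulr_sumr ler_wpM2l ?mulr_ge0 ?(ltW b0) ?(ltW xpos)// inv_squares_lt1.
have S2 : `|S n.+1 (Num.truncn x).+1| <= B * x * n%:R^-1.
  apply: le_trans (ler_norm_sum _ _ _) _.
  apply: (@le_trans _ _ (\sum_(n.+1 <= d < (Num.truncn x).+1) B * x * (d%:R ^+ 2)^-1)).
    apply: ler_sum_nat => d /andP[d2 dn]; rewrite -mulrA; apply: NB.
    have dpos : 0 < d%:R :> R by rewrite ltr0n (leq_trans _ d2).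
    by rewrite divr_gt0 ?exprn_gt0.
  by rewrite -mulr_sumr ler_wpM2l ?mulr_ge0 ?(ltW xpos)// inv_squares_tail.
have S3 : B * x * n%:R^-1 <= b / 16 * x.
  have -> : B * x * n%:R^-1 = (16 * B / b) / n%:R * (b / 16 * x).
    by field; rewrite !gt_eqF.
  rewrite -[leRHS]mul1r ler_wpM2r ?mulr_ge0 ?divr_ge0 ?(ltW b0) ?(ltW xpos)//.
  by rewrite ler_pdivrMr// mul1r ltW.
have -> : N x = inv_square_transform N x - S 2%N n.+1 - S n.+1 (Num.truncn x).+1.
  by rewrite split; lra.
apply: le_trans (ler_normB _ _) _; apply: le_trans (lerD (ler_normB _ _) (lexx _)) _.
by lra.
Unshelve. all: by end_near. Qed.

Lemma inv_square_transform_cvg0 (R : realType) (N : R -> R) (B : R) :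
  (forall y, 0 < y -> `|N y| <= B * y) ->
  inv_square_transform N x / x @[x --> +oo] --> 0 ->
  N x / x @[x --> +oo] --> 0.
Proof.
move=> NB cvT; have B0 : 0 <= B by have := NB 1 ltr01; rewrite mulr1; exact: le_trans.
(* The contraction is iterated from the global bound; [B + 1] replaces [B] because the constant must
   be strictly positive. *)
have bound k : \forall x \near +oo, `|N x| <= (7 / 8) ^+ k * (B + 1) * x.
  elim: k => [|k IH].
    near=> x; have x0 : 0 < x by [].
    by apply: le_trans (NB _ x0) _; rewrite mul1r ler_wpM2r ?(ltW x0)// lerDl.
  rewrite exprS -!mulrA mulrA mulrA -[_ * (B + 1)]mulrA.
  apply: (inv_square_transform_contraction NB cvT) => //.
  by rewrite mulr_gt0 ?exprn_gt0 ?divr_gt0// ltr_wpDl.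
apply/cvgr0Pnorm_le => e e0.
have : (7 / 8 : R) ^+ k * (B + 1) @[k --> \oo] --> 0 * (B + 1).
  apply: cvgMl; apply: cvg_expr; rewrite ger0_norm; lra.
rewrite mul0r => /cvgr0Pnorm_le /(_ e e0)[k _ /(_ k (leqnn k))] /= ke.
near=> x.
have x0 : 0 < x by [].
rewrite normrM normfV (gtr0_norm x0) ler_pdivrMr//.
have : `|N x| <= (7 / 8) ^+ k * (B + 1) * x by near: x; exact: bound.
move=> /le_trans; apply; rewrite ler_wpM2r ?(ltW x0)//.
exact: le_trans (ler_norm _) ke.
Unshelve. all: by end_near. Qed.

(** The linear function [c / Z * x] has transform [c / Z * x * inv_squares (truncn x)], asymptotic
    to [c * x]. Subtracting it from [N] leaves a function whose transform is negligible against [x],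
    to which the case of limit 0 applies. *)
Lemma inv_square_inversion (R : realType) (N : R -> R) (B c Z : R) :
  (forall y, 0 < y -> `|N y| <= B * y) ->
  0 < Z -> inv_squares R n @[n --> \oo] --> Z ->
  inv_square_transform N x / x @[x --> +oo] --> c ->
  N x / x @[x --> +oo] --> c / Z.
Proof.
move=> NB Z0 cvZ cvT.
pose N' x := N x - c / Z * x.
have NB' y : 0 < y -> `|N' y| <= (B + `|c / Z|) * y.
  move=> y0; apply: le_trans (ler_normB _ _) _; rewrite mulrDl lerD ?NB//.
  by rewrite normrM (gtr0_norm y0).
have TE x : 0 < x -> inv_square_transform N x / x -
    c / Z * inv_squares R (Num.truncn x) = inv_square_transform N' x / x.
  move=> x0; rewrite /inv_square_transform /N' sumrB mulrBl; congr (_ - _).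
  rewrite /inv_squares mulr_sumr mulr_suml; apply: eq_big_nat => d /andP[d0 _].
  by field; rewrite !gt_eqF// ltr0n.
have cvT' : inv_square_transform N' x / x @[x --> +oo] --> 0.
  have : inv_square_transform N x / x - c / Z * inv_squares R (Num.truncn x)
      @[x --> +oo] --> c - c / Z * Z.
    apply: cvgB => //; apply: cvgMr.
    exact: cvg_comp (@truncn_cvg R) cvZ.
  rewrite divfK ?gt_eqF// subrr; apply: cvg_trans; apply: near_eq_cvg.
  by near=> x; rewrite TE.
have : N' x / x + c / Z @[x --> +oo] --> 0 + c / Z.
  apply: cvgD; last exact: cvg_cst.
  exact: inv_square_transform_cvg0 NB' cvT'.
rewrite add0r; apply: cvg_trans; apply: near_eq_cvg.
near=> x; have x0 : 0 < x by [].
by rewrite /N'/=; field; rewrite !gt_eqF.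
Unshelve. all: by end_near. Qed.

(** The constant [Z], the sum of all [1 / d ^ 2], is chosen before [g], [F] and the slope interval,
    so that it cancels in ratios of counts. *)
Lemma setcard_primitive_region_cvg (R : realType) :
  exists2 Z : R, 0 < Z & forall (g F : R -> R) (p q : R),
    slope_density g F p q ->
    (setcard (primitive_region g `[p, q] x))%:R / x @[x --> +oo] -->
      (F q - F p) / Z.
Proof.
have [Z Z0 cvZ] := inv_squares_cvg R; exists Z => // g F p q gF.
apply: (@inv_square_inversion R (fun x => (setcard (primitive_region g `[p, q] x))%:R)
  (3 * (1 + (q - p)))) => //.
  move=> y y0; rewrite normr_nat; apply: le_trans (setcard_region_le gF y0).
  rewrite ler_nat; apply: setcard_le; last exact: subIsetl.
  exact: finite_slope_region gF (lexx p) (lexx q).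
have := setcard_region_cvg gF; apply: cvg_trans; apply: near_eq_cvg; near=> x.
have x0 : 0 < x by [].
by rewrite (setcard_region_sum gF (ltW x0)) natr_sum.
Unshelve. all: by end_near. Qed.

(** * CM points as primitive lattice points *)

Lemma slope_primitive_lt (R : realType) (g F : R -> R) (p q : R) :
  slope_density g F p q -> p < q -> F p < F q.
Proof.
move=> [p0 _ g1 _ _ dF] pq.
have [||r rpq FE] := @MVT _ F (fun r => (2 * g r)^-1) _ _ pq.
- move=> r; rewrite in_itv/= => /andP[/ltW pr /ltW rq].
  by apply: dF; rewrite pr.
- apply: derivable_within_continuous => r; rewrite in_itv/= => rpq.
  by have [] := dF r rpq.
- rewrite -subr_gt0 FE mulr_gt0 ?subr_gt0// invr_gt0 mulr_gt0//.
  apply: lt_le_trans (g1 r _) => //.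
  by move: rpq; rewrite in_itv/= => /andP[/ltW -> /ltW ->].
Qed.

Lemma primitive_region_ratio_cvg (R : realType) (g F : R -> R)
    (p q p' q' : R) :
  slope_density g F p q -> slope_density g F p' q' -> p' < q' ->
  (setcard (primitive_region g `[p, q] x))%:R /
  (setcard (primitive_region g `[p', q'] x))%:R @[x --> +oo] -->
  (F q - F p) / (F q' - F p').
Proof.
move=> gF gF' pq'; have [Z Z0 cvN] := @setcard_primitive_region_cvg R.
have F0 : F q' - F p' != 0.
  by rewrite gt_eqF// subr_gt0; exact: slope_primitive_lt gF' pq'.
have FZ : (F q' - F p') / Z != 0 by rewrite mulf_neq0 ?invr_eq0 ?(gt_eqF Z0).
have -> : (F q - F p) / (F q' - F p') =
    (F q - F p) / Z * ((F q' - F p') / Z)^-1.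
  by field; rewrite F0 gt_eqF.
have : (setcard (primitive_region g `[p, q] x))%:R / x *
    ((setcard (primitive_region g `[p', q'] x))%:R / x)^-1 @[x --> +oo] -->
    (F q - F p) / Z * ((F q' - F p') / Z)^-1.
  by apply: cvgM; [exact: cvN|apply: cvgV => //; exact: cvN].
apply: cvg_trans; apply: near_eq_cvg.
near=> x; have x0 : 0 < x by [].
by rewrite /= invfM invrK mulrACA [x^-1 * x]mulVf ?gt_eqF// mulr1.
Unshelve. all: by end_near. Qed.

Lemma Rintegral_primitive (R : realType) (f F : R -> R) (a b : R) :
  a <= b -> {within `[a, b], continuous f} ->
  (forall x, a <= x <= b -> is_derive x 1 F (f x)) ->
  \int[lebesgue_measure]_(x in `[a, b]) f x = F b - F a.
Proof.
rewrite le_eqVlt => /predU1P[<- _ _|ab cf dF].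
  by rewrite set_itv1 Rintegral_set1 subrr.
have cF x : a <= x <= b -> {for x, continuous F}.
  move=> /dF[dFx _]; apply: differentiable_continuous.
  exact/derivable1_diffP.
rewrite /Rintegral (@continuous_FTC2 _ _ F)//; last first.
- move=> x; rewrite in_itv/= => /andP[/ltW ax /ltW xb].
  rewrite derive1E; have axb : a <= x <= b by rewrite ax.
  exact: (@derive_val _ _ _ _ _ _ _ (dF x axb)).
- split.
  + move=> x; rewrite in_itv/= => /andP[/ltW ax /ltW xb].
    by have [] : is_derive x 1 F (f x) by apply: dF; rewrite ax.
  + by apply/cvg_at_right_filter/cF; rewrite lexx ltW.
  + by apply/cvg_at_left_filter/cF; rewrite lexx ltW.
Qed.

(* A root [x + i y], with [y > 0], of the primitive form [a, b, c] has
   [x = - b / (2 * a)] and [x ^ 2 + y ^ 2 = c / a], whence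
   [|D| = 4 * a * c - b ^ 2 = 4 * a ^ 2 * y ^ 2]. *)
Lemma cm_pointsP (R : realType) (Delta x y : R) : 0 < y ->
  cm_points Delta (x +i* y) <->
  exists a b c : int, [/\ 1 <= a, gcdz (gcdz a b) c = 1,
    b%:~R = - 2 * a%:~R * x, c%:~R = a%:~R * (x ^+ 2 + y ^+ 2) &
    4 * a%:~R ^+ 2 * y ^+ 2 <= Delta].
Proof.
move=> y0.
have formE (a b c : int) :
    a%:~R * (x +i* y) ^+ 2 + b%:~R * (x +i* y) + c%:~R =
    (a%:~R * (x ^+ 2 - y ^+ 2) + b%:~R * x + c%:~R) +i*
    ((2 * a%:~R * x + b%:~R) * y).
  have intC (k : int) : k%:~R = (k%:~R)%:C :> R[i] by rewrite rmorph_int.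
  rewrite !intC expr2; simpc; apply/eqP; rewrite eq_complex/=.
  by apply/andP; split; apply/eqP; ring.
have discE (a b c : int) : b%:~R = - 2 * a%:~R * x ->
    c%:~R = a%:~R * (x ^+ 2 + y ^+ 2) ->
    `|b ^+ 2 - 4 * a * c|%:~R = 4 * a%:~R ^+ 2 * y ^+ 2 :> R.
  move=> bE cE; rewrite intr_norm !(rmorphB, rmorphM, rmorphXn)/= bE cE.
  have -> : (- 2 * a%:~R * x) ^+ 2 - 4%:~R * a%:~R * (a%:~R * (x ^+ 2 + y ^+ 2))
    = - (2 * a%:~R * y) ^+ 2 by ring.
  by rewrite normrN ger0_norm ?sqr_ge0//; ring.
split.
- move=> [D [DD [_ [a [b [c [[a1 gabc] eq0 DE]]]]]]].
  move: eq0; rewrite formE => /eqP; rewrite eq_complex/= => /andP[/eqP re].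
  rewrite mulf_eq0 (gt_eqF y0) orbF => /eqP im.
  have bE : b%:~R = - 2 * a%:~R * x by lra.
  have cE : c%:~R = a%:~R * (x ^+ 2 + y ^+ 2) by move: re; rewrite bE; lra.
  by exists a, b, c; split => //; rewrite -(discE _ _ _ bE cE) -DE.
- move=> [a [b [c [a1 gabc bE cE aD]]]]; exists (b ^+ 2 - 4 * a * c).
  rewrite discE//; split => //; split => //; exists a, b, c; split => //.
  split => //; rewrite formE; apply/eqP; rewrite eq_complex/= bE cE.
  by apply/andP; split; apply/eqP; ring.
Qed.

(** * Slope densities of the left boundary and of the lower arc *)

Definition left_boundary_density (R : realType) (r : R) : R := 4 * r - 1.

Definition left_boundary_primitive (R : realType) (r : R) : R :=
  8^-1 * ln (4 * r - 1).

(** The bound 1 on slopes is the value of [y ^ 2 + 1 / 4] at the corner [y = sqrt 3 / 2]; from there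
    on the density is increasing and at least 3. *)
Lemma left_boundary_slope_density (R : realType) (p q : R) :
  1 <= p -> p <= q ->
  slope_density (@left_boundary_density R) (@left_boundary_primitive R) p q.
Proof.
rewrite /left_boundary_density => p1 pq; split.
- lra.
- exact: pq.
- by move=> r /andP[? ?]; lra.
- move=> s r t ps sr rt tq; rewrite ge_min le_max; apply/andP; split.
    by apply/orP; left; lra.
  by apply/orP; right; lra.
- exists 4 => // s t _ st _; rewrite ger0_norm; lra.
- move=> r /andP[pr _]; have r0 : 0 < 4 * r - 1 by lra.
  rewrite /left_boundary_primitive.
  have dl := is_derive1_ln r0.
  have da : is_derive r 1 (fun r : R => 4 * r - 1) 4.
    by apply: is_derive_eq; rewrite /GRing.scale/= mulr1 subr0.
  have dc := @is_derive1_comp R (@ln R) (fun r => 4 * r - 1) r _ _ dl da.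
  have -> : (2 * (4 * r - 1))^-1 = 8^-1 *: ((4 * r - 1)^-1 * 4) :> R.
    by rewrite /GRing.scale/=; field; rewrite gt_eqF.
  exact: (is_deriveZ (8^-1) dc).
Qed.

Definition lower_arc_density (R : realType) (r : R) : R := 4 - r ^+ 2.

(** Obtained from the partial fractions [1 / (2 * (4 - r ^ 2)) = (1 / (2 + r) + 1 / (2 - r)) /
    8]. *)
Definition lower_arc_primitive (R : realType) (r : R) : R :=
  8^-1 * (ln (2 + r) - ln (2 - r)).

(** On [[0, 1]] the density decreases from 4 to 3 and its derivative [- 2 * r] is at most 2 in
    absolute value. *)
Lemma lower_arc_slope_density (R : realType) (p q : R) :
  0 <= p -> p <= q -> q <= 1 ->
  slope_density (@lower_arc_density R) (@lower_arc_primitive R) p q.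
Proof.
rewrite /lower_arc_density => p0 pq q1; split.
- exact: p0.
- exact: pq.
- by move=> r /andP[? ?]; nra.
- move=> s r t ps sr rt tq; rewrite ge_min le_max; apply/andP; split.
    by apply/orP; right; nra.
  by apply/orP; left; nra.
- by exists 2 => // s t ps st tq; rewrite ler_norml; apply/andP; split; nra.
- move=> r /andP[pr rq]; rewrite /lower_arc_primitive.
  have r1 : 0 < 2 + r by lra.
  have r2 : 0 < 2 - r by lra.
  have d1 : is_derive r 1 (fun r : R => 2 + r) 1.
    by apply: is_derive_eq; rewrite add0r mul1r.
  have d2 : is_derive r 1 (fun r : R => 2 - r) (- 1).
    by apply: is_derive_eq; rewrite add0r mul1r.
  have e1 := @is_derive1_comp R (@ln R) (fun r => 2 + r) r _ _
    (is_derive1_ln r1) d1.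
  have e2 := @is_derive1_comp R (@ln R) (fun r => 2 - r) r _ _
    (is_derive1_ln r2) d2.
  have -> : (2 * (4 - r ^+ 2))^-1 =
      8^-1 *: ((2 + r)^-1 * 1 - (2 - r)^-1 * - 1) :> R.
    by rewrite /GRing.scale/=; field; rewrite !gt_eqF//=; nra.
  exact: (is_deriveZ (8^-1) (is_deriveB e1 e2)).
Qed.

(** * Boundary CM points parametrized by coprime pairs *)

Lemma slope_inj (R : realType) :
  {in [pred ab | (0 < ab.1)%N && coprime ab.1 ab.2] &, injective (slope R)}.
Proof.
move=> [a b] [a' b']; rewrite !inE/= => /andP[a0 ab] /andP[a'0 ab'].
rewrite /slope/= => /eqP; rewrite eqr_div ?pnatr_eq0 -?lt0n//.
rewrite -!natrM eqr_nat => /eqP bb'.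
(* By Gauss's lemma, applied to the cross-multiplied equality, each denominator divides the
   other. *)
have aa' : a = a'.
  apply/eqP; rewrite eqn_dvd; apply/andP; split.
    by rewrite -(Gauss_dvdr _ ab) bb' dvdn_mull.
  by rewrite -(Gauss_dvdr _ ab') -bb' dvdn_mull.
move: bb'; rewrite -aa' => /eqP; rewrite eqn_pmul2r// => /eqP ->.
by [].
Qed.

(** The map [psi] reads the slope off the point [phi ab], and a slope determines its coprime pair;
    so [phi] is injective on the primitive region. *)
Lemma ncard_primitive_image (R : realType) (g F : R -> R) (p q x : R)
    (phi : nat * nat -> R[i]) (psi : R[i] -> R) (A : set R[i]) :
  slope_density g F p q ->
  (forall ab, slope R ab \in `[p, q] -> psi (phi ab) = slope R ab) ->
  A = phi @` primitive_region g `[p, q] x ->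
  ncard A = (setcard (primitive_region g `[p, q] x))%:R.
Proof.
move=> gF psiK ->; congr _%:R; apply: setcard_image.
  apply: sub_finite_set (finite_slope_region x true gF (lexx p) (lexx q)).
  exact: subIsetl.
move=> ab ab'; rewrite !inE => -[[a0 abI _] cop] [[a'0 ab'I _] cop'] phiE.
apply: (@slope_inj R); rewrite ?inE/= ?a0 ?a'0//.
by rewrite -(psiK _ abI) -(psiK _ ab'I) phiE.
Qed.

(** Real part [- 1 / 2] forces [b = a], so primitivity of the form becomes coprimality of [a] and
    [c]. The slope is [c / a = y ^ 2 + 1 / 4], increasing in [y], and [4 * a ^ 2 * y ^ 2] becomes
    [a ^ 2 * (4 * r - 1)]. *)
Lemma cm_left_boundary_image (R : realType) (Delta X Y : R) :
  Num.sqrt 3 / 2 <= X -> X <= Y ->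
  cm_left_boundary Delta `&` [set tau | X <= complex.Im tau <= Y] =
  (fun ab => (- (1 / 2)) +i* Num.sqrt (slope R ab - 1 / 4)) @`
    primitive_region (@left_boundary_density R)
      `[X ^+ 2 + 1 / 4, Y ^+ 2 + 1 / 4] Delta.
Proof.
move=> X3 XY; have s30 : 0 < Num.sqrt 3 :> R by rewrite sqrtr_gt0.
have X0 : 0 < X by lra.
apply/seteqP; split => tau.
- move=> [[cm [y [y3 tauE]]]]; rewrite tauE/= in cm * => /andP[Xy yY].
  have y0 : 0 < y by lra.
  have [a [b [c [a1 gabc bE cE aD]]]] := (cm_pointsP Delta (- (1 / 2)) y0).1 cm.
  case: a a1 gabc bE cE aD => // a a1 gabc bE cE aD.
  have ba : b = a by apply: (@intr_inj R); rewrite bE; lra.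
  have a0 : (0 < a)%N by [].
  have aR : 0 < a%:R :> R by rewrite ltr0n.
  have {}cE : c%:~R = a%:R * (y ^+ 2 + 1 / 4) :> R by rewrite cE; lra.
  have c0 : 0 <= c by rewrite -(ler0z R) cE mulr_ge0// addr_ge0// sqr_ge0.
  case: c c0 gabc cE => // c _ gabc cE.
  have sl : slope R (a, c) = y ^+ 2 + 1 / 4.
    by rewrite /slope/= -[c%:R]/(c%:~R) cE mulrC mulKf// gt_eqF.
  exists (a, c); last first.
    by rewrite /= sl addrK sqrtr_sqr gtr0_norm.
  split; [split => //|].
  + by rewrite sl in_itv/= !lerD2r !ler_sqr ?nnegrE; lra.
  + by rewrite sl /left_boundary_density/=; move: aD; rewrite -pmulrn; lra.
  + by move: gabc; rewrite ba /gcdz/= gcdnn /coprime => -[->].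
- move=> [[a c] [[/= a0 + aD] cop] <-].
  have aR : 0 < a%:R :> R by rewrite ltr0n.
  rewrite in_itv/=; set r := slope R _ in aD * => /andP[Xr rY].
  have r0 : 0 <= r - 1 / 4 by have := sqr_ge0 X; lra.
  have y2 := sqr_sqrtr r0; set y := Num.sqrt _ in y2 *.
  have y0 : 0 <= y by exact: sqrtr_ge0.
  have Xy : X <= y by rewrite -(@ler_sqr R) ?nnegrE ?(ltW X0)//; lra.
  have yY : y <= Y by rewrite -(@ler_sqr R) ?nnegrE; lra.
  split; last by rewrite /= Xy.
  split; last by exists y; split => //; lra.
  apply/cm_pointsP; first by lra.
  exists a, a, c; split => //.
  + by rewrite /gcdz/= gcdnn; congr Posz; exact/eqP.
  + by lra.
  + have cE : c%:R = r * a%:R by rewrite /r /slope/= divfK ?gt_eqF.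
    by rewrite -!pmulrn cE y2; lra.
  + by rewrite y2; move: aD; rewrite /left_boundary_density -pmulrn; lra.
Qed.

(** With [c = cos (pi / 3)], the reflection and double angle formulas give [- c = 2 * c ^ 2 - 1],
    that is [(2 * c - 1) * (c + 1) = 0], and [c > 0]. *)
Lemma cos_pi23 (R : realType) : cos (2 * pi / 3) = - (1 / 2) :> R.
Proof.
have pi0 := pi_gt0 R.
have c3 : 0 < cos (pi / 3) :> R.
  by apply: cos_gt0_pihalf; apply/andP; split; lra.
have c23 : cos (2 * pi / 3) = - cos (pi / 3) :> R.
  have -> : 2 * pi / 3 = - (pi / 3) + pi :> R by lra.
  by rewrite cosDpi cosN.
have : cos (2 * pi / 3) = cos (pi / 3) ^+ 2 *+ 2 - 1 :> R.
  rewrite -cos_mulr2n; congr cos; rewrite mulr2n; lra.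
rewrite c23; set c := cos _ in c3 * => cE.
have : (2 * c - 1) * (c + 1) = 0 by rewrite mulr2n in cE; lra.
by move=> /eqP; rewrite mulf_eq0 => /orP[|]/eqP; lra.
Qed.

Lemma arg_expi (R : realType) (theta : R) :
  0 < theta < pi -> arg (expi theta) = theta.
Proof.
move=> /andP[t0 tpi]; have st : 0 < sin theta by rewrite sin_gt0_pi// t0.
have normE : `|expi theta| = 1.
  by rewrite normc_def /= cos2Dsin2 sqrtr1.
rewrite /arg normE; apply: xget_unique => [|y [/andP[ypi piy]]] /=.
  by rewrite mul1r; split => //; apply/andP; split; lra.
rewrite mul1r => -[cE sE].
(* An angle in []-pi, 0]] has nonpositive sine, so [y] lies in []0, pi]], where the cosine
   determines the angle. *)
have y0 : 0 < y.
  rewrite ltNge; apply/negP => y0.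
  suff : 0 <= sin (- y) by rewrite sinN; lra.
  by apply: sin_ge0_pi; apply/andP; split; lra.
by apply: cos_inj; rewrite ?in_itv/= //; apply/andP; split; lra.
Qed.

Lemma ler_cos (R : realType) :
  {in `[0, pi] &, {mono @cos R : x y /~ y <= x}}.
Proof. by move=> x y xpi ypi; rewrite !leNgt ltr_cos. Qed.

Lemma lower_arc_angle (R : realType) (theta : R) :
  pi / 2 <= theta <= 2 * pi / 3 ->
  [/\ 0 < theta < pi, 0 < sin theta & 0 <= - 2 * cos theta <= 1].
Proof.
have pi0 := pi_gt0 R; move=> /andP[t1 t2].
have tpi : 0 < theta < pi by apply/andP; split; lra.
have inpi (u : R) : 0 <= u -> u <= pi -> u \in `[0, pi].
  by move=> *; rewrite in_itv/=; apply/andP.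
split => //; first exact: sin_gt0_pi.
have c1 : cos theta <= cos (pi / 2).
  by rewrite ler_cos// ?inpi//; lra.
have c2 : cos (2 * pi / 3) <= cos theta.
  by rewrite ler_cos// ?inpi//; lra.
move: c1 c2; rewrite cos_pihalf cos_pi23 => c1 c2.
by apply/andP; split; lra.
Qed.

(** Modulus 1 forces [c = a], so primitivity becomes coprimality of [a] and [b], with slope
    [b / a = - 2 * cos theta] in [[0, 1]]. As the cosine decreases, the slope increases with the
    angle and the endpoints keep their order. The bound on [4 * a ^ 2 * sin theta ^ 2] becomes one
    on [a ^ 2 * (4 - r ^ 2)]. *)
Lemma cm_lower_arc_image (R : realType) (Delta alpha beta : R) :
  pi / 2 <= alpha -> alpha <= beta -> beta <= 2 * pi / 3 ->
  cm_lower_arc Delta `&` [set tau | alpha <= arg tau <= beta] =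
  (fun ab => (- (slope R ab / 2)) +i* Num.sqrt (1 - (slope R ab / 2) ^+ 2)) @`
    primitive_region (@lower_arc_density R)
      `[- 2 * cos alpha, - 2 * cos beta] Delta.
Proof.
have pi0 := pi_gt0 R; move=> alpha1 alphabeta beta1.
have inpi (u : R) : 0 <= u -> u <= pi -> u \in `[0, pi].
  by move=> *; rewrite in_itv/=; apply/andP.
have alphapi : alpha \in `[0, pi] by apply: inpi; lra.
have betapi : beta \in `[0, pi] by apply: inpi; lra.
apply/seteqP; split => tau.
- move=> [[cm [theta [thetaI tauE]]]]; rewrite tauE/= in cm *.
  have [thetapi st /andP[sl0 sl1]] := lower_arc_angle thetaI.
  rewrite arg_expi// => /andP[alphatheta thetabeta].
  have [a [b [c [a1 gabc bE cE aD]]]] := (cm_pointsP Delta (cos theta) st).1 cm.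
  case: a a1 gabc bE cE aD => // a a1 gabc bE cE aD.
  have ca : c = a.
    by apply: (@intr_inj R); rewrite cE cos2Dsin2 mulr1.
  have a0 : (0 < a)%N by [].
  have aR : 0 < a%:R :> R by rewrite ltr0n.
  have {}bE : b%:~R = a%:R * (- 2 * cos theta) :> R by rewrite bE -pmulrn; lra.
  have b0 : 0 <= b by rewrite -(ler0z R) bE mulr_ge0.
  case: b b0 gabc bE => // b _ gabc bE.
  have sl : slope R (a, b) = - 2 * cos theta.
    by rewrite /slope/= -[b%:R]/(b%:~R) bE mulrC mulKf// gt_eqF.
  have sl2 : slope R (a, b) / 2 = - cos theta by rewrite sl; lra.
  exists (a, b); last first.
    by rewrite /= sl2 opprK sqrrN -sin2cos2 sqrtr_sqr gtr0_norm.
  have thpi : theta \in `[0, pi] by apply: inpi; move/andP: thetapi => []; lra.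
  have c1 : cos theta <= cos alpha by rewrite ler_cos.
  have c2 : cos beta <= cos theta by rewrite ler_cos.
  split; [split => //|].
  + by rewrite sl in_itv/=; apply/andP; split; lra.
  + rewrite sl /lower_arc_density/=; move: aD; rewrite -pmulrn sin2cos2; lra.
  + by move: gabc; rewrite ca /gcdz/= gcdnAC gcdnn /coprime => -[->].
- move=> [[a b] [[/= a0 + aD] cop] <-].
  have aR : 0 < a%:R :> R by rewrite ltr0n.
  rewrite in_itv/=; set r := slope R _ in aD * => /andP[alphar rbeta].
  have r2pi : pi / 2 <= alpha <= 2 * pi / 3 by apply/andP; split; lra.
  have r3pi : pi / 2 <= beta <= 2 * pi / 3 by apply/andP; split; lra.
  have [_ _ /andP[alpha0 _]] := lower_arc_angle r2pi.
  have [_ _ /andP[_ beta2]] := lower_arc_angle r3pi.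
  have r1 : -1 <= - (r / 2) <= 1 by apply/andP; split; lra.
  (* Conversely the angle is recovered from the slope through [r = - 2 * cos theta]. *)
  pose theta := acos (- (r / 2)).
  have cE : cos theta = - (r / 2) by rewrite acosK// in_itv.
  have thpi : theta \in `[0, pi] by apply: inpi; [exact: acos_ge0|exact: acos_lepi].
  have alphatheta : alpha <= theta by rewrite -ler_cos// cE; lra.
  have thetabeta : theta <= beta by rewrite -ler_cos// cE; lra.
  have thetaI : pi / 2 <= theta <= 2 * pi / 3 by apply/andP; split; lra.
  have [thetapi st _] := lower_arc_angle thetaI.
  have -> : (- (r / 2)) +i* Num.sqrt (1 - (r / 2) ^+ 2) = expi theta.
    by rewrite /expi cE -sqrrN -cE -sin2cos2 sqrtr_sqr gtr0_norm.
  split; last by rewrite /= arg_expi// alphatheta.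
  split; last by exists theta.
  apply/cm_pointsP => //; exists a, b, a; split => //.
  + by rewrite /gcdz/= gcdnAC gcdnn; congr Posz; exact/eqP.
  + have bE : b%:R = r * a%:R by rewrite /r /slope/= divfK ?gt_eqF.
    by rewrite -!pmulrn bE cE; lra.
  + by rewrite cos2Dsin2 mulr1.
  + by rewrite sin2cos2 cE; move: aD; rewrite /lower_arc_density -pmulrn; lra.
Qed.

(** * The integrals of dy / y and of d theta / sin theta *)

Lemma left_boundary_integral (R : realType) (a b : R) : 0 < a -> a <= b ->
  \int[lebesgue_measure]_(y in `[a, b]) y^-1 =
  4 * (left_boundary_primitive (b ^+ 2 + 1 / 4) -
       left_boundary_primitive (a ^+ 2 + 1 / 4)).
Proof.
move=> a0 ab.
have lnE (y : R) : 0 < y ->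
    left_boundary_primitive (y ^+ 2 + 1 / 4) = 8^-1 * (ln 4 + 2 * ln y).
  move=> y0; rewrite /left_boundary_primitive.
  (* At the slope of [y] the logarithm splits as [ln 4 + 2 * ln y]; the constant cancels between
     endpoints and [4 * 8^-1 * 2 = 1]. *)
  have -> : 4 * (y ^+ 2 + 1 / 4) - 1 = 4 * (y * y) by field.
  by rewrite !lnM ?posrE ?mulr_gt0// mulr_natl mulr2n.
rewrite !lnE//; last exact: lt_le_trans ab.
transitivity (ln b - ln a); last by field.
apply: (@Rintegral_primitive R (@GRing.inv R) (@ln R)); first exact: ab.
- apply: continuous_in_subspaceT => y; rewrite inE/= in_itv/= => /andP[ay _].
  by apply: cvgV; [rewrite gt_eqF// (lt_le_trans a0)|exact: cvg_id].
- by move=> y /andP[ay _]; apply: is_derive1_ln; exact: lt_le_trans ay.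
Qed.

(** For [r = - 2 * cos t] one has [4 - r ^ 2 = 4 * sin t ^ 2] and [dr = 2 * sin t * dt], so the area
    density [dr / (2 * (4 - r ^ 2))] is [dt / (4 * sin t)]. *)
Lemma lower_arc_integral (R : realType) (a b : R) :
  pi / 2 <= a -> a <= b -> b <= 2 * pi / 3 ->
  \int[lebesgue_measure]_(theta in `[a, b]) (sin theta)^-1 =
  4 * (lower_arc_primitive (- 2 * cos b) - lower_arc_primitive (- 2 * cos a)).
Proof.
move=> pia ab bpi; rewrite mulrBr.
have angle (t : R) : a <= t <= b -> 0 < sin t /\ 0 <= - 2 * cos t <= 1.
  move=> /andP[a_t tb]; have tI : pi / 2 <= t <= 2 * pi / 3.
    by rewrite (le_trans pia)// (le_trans tb).
  by have [] := lower_arc_angle tI.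
apply: (@Rintegral_primitive _ _
  (fun t => 4 * lower_arc_primitive (- 2 * cos t))); first exact: ab.
- apply: continuous_in_subspaceT => t; rewrite inE/= in_itv/= => /angle[st _].
  by apply: cvgV; [rewrite gt_eqF|exact: continuous_sin].
- move=> t /angle[st tI].
  have dF := density_primitive (lower_arc_slope_density (lexx 0) ler01 (lexx 1)) tI.
  have dc : is_derive t 1 (fun t : R => - 2 * cos t) (- 2 *: - sin t).
    exact: is_deriveZ.
  have -> : (sin t)^-1 =
      4 *: ((2 * lower_arc_density (- 2 * cos t))^-1 * (- 2 *: - sin t)) :> R.
    rewrite /lower_arc_density /GRing.scale/=.
    have -> : 4 - (- 2 * cos t) ^+ 2 = 4 * sin t ^+ 2 by rewrite sin2cos2; ring.
    by field; rewrite gt_eqF.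
  exact: (is_deriveZ 4 (@is_derive1_comp R (@lower_arc_primitive R)
    (fun t => - 2 * cos t) t _ _ dF dc)).
Qed.

Theorem theorem1p1 (R : realType) :
  (forall K : R, Num.sqrt 3 / 2 < K ->
   forall X Y : R, Num.sqrt 3 / 2 <= X -> X <= Y -> Y <= K ->
     (ncard (cm_left_boundary Delta `&`
               [set tau | X <= complex.Im tau <= Y]) /
      ncard (cm_left_boundary Delta `&`
               [set tau | Num.sqrt 3 / 2 <= complex.Im tau <= K]))
       @[Delta --> +oo] -->
     (\int[lebesgue_measure]_(y in `[X, Y]) y^-1) /
     (\int[lebesgue_measure]_(y in `[(Num.sqrt 3 / 2 : R), K]) y^-1))
  /\
  (forall alpha beta : R, pi / 2 <= alpha -> alpha <= beta ->
     beta <= 2 * pi / 3 ->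
     (ncard (cm_lower_arc Delta `&`
               [set tau | alpha <= arg tau <= beta]) /
      ncard (cm_lower_arc Delta))
       @[Delta --> +oo] -->
     (\int[lebesgue_measure]_(theta in `[alpha, beta]) (sin theta)^-1) /
     (\int[lebesgue_measure]_(theta in `[(pi / 2 : R), 2 * pi / 3])
        (sin theta)^-1)).
Proof.
have s30 : 0 < Num.sqrt 3 :> R by rewrite sqrtr_gt0.
have s3 : Num.sqrt 3 ^+ 2 = 3 :> R by rewrite sqr_sqrtr.
have pi0 := pi_gt0 R.
split.
- move=> K K3 X Y X3 XY YK.
  have dens (u v : R) : Num.sqrt 3 / 2 <= u -> u <= v ->
      slope_density (@left_boundary_density R) (@left_boundary_primitive R)
        (u ^+ 2 + 1 / 4) (v ^+ 2 + 1 / 4).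
    by move=> u3 uv; apply: left_boundary_slope_density; nra.
  have count Delta (u v : R) : Num.sqrt 3 / 2 <= u -> u <= v ->
      ncard (cm_left_boundary Delta `&` [set tau | u <= complex.Im tau <= v]) =
      (setcard (primitive_region (@left_boundary_density R)
        `[u ^+ 2 + 1 / 4, v ^+ 2 + 1 / 4] Delta))%:R.
    move=> u3 uv; apply: (ncard_primitive_image (dens _ _ u3 uv) _
      (cm_left_boundary_image Delta u3 uv)
      (psi := fun tau => complex.Im tau ^+ 2 + 1 / 4)) => ab.
    rewrite in_itv/= => /andP[ur _]; rewrite sqr_sqrtr; first by rewrite subrK.
    by have := sqr_ge0 u; lra.
  under eq_fun do rewrite (count _ X Y)// (count _ _ K) ?lexx ?(ltW K3)//.
  rewrite !left_boundary_integral ?(ltW K3)//; try lra.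
  (* The factor 4 between integral and area is common to numerator and denominator. *)
  rewrite -mulf_div divff ?pnatr_eq0// [1 * (_ / _)]mul1r.
  apply: primitive_region_ratio_cvg; [exact: dens|apply: dens; lra|].
  by nra.
- move=> alpha beta alpha1 alphabeta beta1.
  have dens (u v : R) : pi / 2 <= u -> u <= v -> v <= 2 * pi / 3 ->
      slope_density (@lower_arc_density R) (@lower_arc_primitive R)
        (- 2 * cos u) (- 2 * cos v).
    move=> u1 uv v1.
    have [|_ _ /andP[? ?]] := @lower_arc_angle R u.
      by rewrite u1 (le_trans uv).
    have [|_ _ /andP[? ?]] := @lower_arc_angle R v.
      by rewrite v1 (le_trans u1).
    apply: lower_arc_slope_density => //.
    have : cos v <= cos u.
      by rewrite ler_cos// in_itv/=; apply/andP; split; lra.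
    by lra.
  have count Delta (u v : R) : pi / 2 <= u -> u <= v -> v <= 2 * pi / 3 ->
      ncard (cm_lower_arc Delta `&` [set tau | u <= arg tau <= v]) =
      (setcard (primitive_region (@lower_arc_density R)
        `[- 2 * cos u, - 2 * cos v] Delta))%:R.
    move=> u1 uv v1; apply: (ncard_primitive_image (dens _ _ u1 uv v1) _
      (cm_lower_arc_image Delta u1 uv v1)
      (psi := fun tau => - 2 * complex.Re tau)) => ab _ /=.
    by field.
  (* The denominator carries no condition on the argument; writing the whole arc as an angular
     window lets the same count serve for it. *)
  have arcE Delta : cm_lower_arc Delta = cm_lower_arc Delta `&`
      [set tau : R[i] | pi / 2 <= arg tau <= 2 * pi / 3].
    apply/esym/setIidPl => _ [_ [theta [thetaI ->]]] /=.
    by have [thetapi _ _] := lower_arc_angle thetaI; rewrite arg_expi.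
  have pi23 : pi / 2 <= 2 * pi / 3 :> R by lra.
  have cdenom Delta : ncard (cm_lower_arc Delta) =
      (setcard (primitive_region (@lower_arc_density R)
        `[- 2 * cos (pi / 2), - 2 * cos (2 * pi / 3)] Delta))%:R.
    by rewrite arcE count.
  under eq_fun do rewrite (count _ alpha)// cdenom.
  rewrite !lower_arc_integral//.
  rewrite -mulf_div divff ?pnatr_eq0// [1 * (_ / _)]mul1r.
  apply: primitive_region_ratio_cvg; [exact: dens|exact: dens|].
  by rewrite cos_pihalf cos_pi23; lra.
Qed.
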